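(* Let $\mathcal{P}:\mathbb{P}(2n)\to\mathbb{R}$ be the purity function $\mathcal{P}(A)=\dfrac{1}{\prod_{j=1}^n d_j(A)}$. Then $\mathcal{P}$ is Fréchet differentiable on $\mathbb{P}(2n)$, and its gradient at $A\in\mathbb{P}(2n)$ is given by $$\nabla\mathcal{P}(A)=-\frac{1}{2\sqrt{\det(A)}}\,M D_{d(A)}^{-1}M^\top$$ for any choice of $M\in\mathrm{SP}^\uparrow(2n,A)$.
   Context: $n$ is a positive integer and $\mathbb{R}^n_{++}$ is the set of vectors in $\mathbb{R}^n$ with strictly positive entries. $\mathbb{S}(2n)$ is the space of real symmetric $2n\times 2n$ matrices with inner product $\langle A,B\rangle=\operatorname{Tr}(A^\top B)$ and the induced (Frobenius) norm; $\mathbb{P}(2n)\subset\mathbb{S}(2n)$ is the open subset of positive definite matrices. Gradients of real functions on $\mathbb{P}(2n)$ are elements of $\mathbb{S}(2n)$. For $x\in\mathbb{R}^n$, $D_x:=\operatorname{Diag}(x)\oplus\operatorname{Diag}(x)$. A real $2n\times 2n$ matrix $M$ is symplectic if $M^\top JM=J$ with $J=\begin{pmatrix}0&I_n\\-I_n&0\end{pmatrix}$. By Williamson's theorem, for each $A\in\mathbb{P}(2n)$ there is a unique vector $d(A)=(d_1(A),\dots,d_n(A))\in\mathbb{R}^n_{++}$ with $d_1(A)\le\cdots\le d_n(A)$ such that $M^\top AM=D_{d(A)}$ for some symplectic $M$. $\mathrm{SP}^\uparrow(2n,A)$ denotes the set of all symplectic $M$ with $M^\top AM=D_{d(A)}$.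 (When $A$ is the covariance matrix of a bosonic Gaussian state, $\mathcal{P}(A)$ is the purity of the state.) *)

(* Defs.v *)
From HB Require Import structures.
From mathcomp Require Import all_boot all_order all_algebra.
From mathcomp Require Import all_classical all_reals all_analysis.
From mathcomp Require Import ring lra.

Set Implicit Arguments.
Unset Strict Implicit.
Unset Printing Implicit Defensive.

Import Order.TTheory GRing.Theory Num.Theory.
Import numFieldNormedType.Exports.

Local Open Scope ring_scope.
Local Open Scope classical_set_scope.

(** The space of real symmetric matrices, normed by the Frobenius norm.  It is
    a separate normed space (not the ambient 'M[R]_m, whose library norm is the
    max norm), so that [differentiable] and ['d f A] are taken in it. *)

Definition sym_pred (R : realType) (m : nat) : {pred 'M[R]_m} :=
  fun A => A \is symmetricmx.

Record symmx (R : realType) (m : nat) := SymMx {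
  symmx_val :> 'M[R]_m;
  symmxP : symmx_val \in @sym_pred R m }.

Section SymmetricMatrices.
Variables (R : realType) (m : nat).
Implicit Types A B : symmx R m.

HB.instance Definition _ := [isSub for @symmx_val R m].
HB.instance Definition _ := [Choice of symmx R m by <:].

Lemma sym_predE (A : 'M[R]_m) : (A \in @sym_pred R m) = (A^T == A).
Proof.
by rewrite /in_mem /= /sym_pred is_hermitianmxE expr0 scale1r map_mx_id // eq_sym.
Qed.

Lemma sym_pred_submod : submod_closed (@sym_pred R m).
Proof.
split=> [|a A B]; rewrite !sym_predE ?trmx0 // => /eqP AE /eqP BE.
by rewrite linearD linearZ /= AE BE.
Qed.

HB.instance Definition _ := GRing.isSubmodClosed.Build R 'M[R]_m
  (@sym_pred R m) sym_pred_submod.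
HB.instance Definition _ := [SubChoice_isSubLmodule of symmx R m by <:].

Lemma symmx_tr A : (val A)^T = val A.
Proof. by apply/eqP; rewrite -sym_predE symmxP. Qed.

Definition frobenius (A B : 'M[R]_m) : R := \tr (A^T *m B).

Definition frobenius_norm (A : 'M[R]_m) : R := Num.sqrt (frobenius A A).

Lemma frobeniusE (A B : 'M[R]_m) :
  frobenius A B = \sum_i \sum_j A i j * B i j.
Proof.
rewrite /frobenius /mxtrace exchange_big; apply: eq_bigr => j _.
by rewrite mxE; apply: eq_bigr => i _; rewrite mxE.
Qed.

Lemma frobeniusC (A B : 'M[R]_m) : frobenius A B = frobenius B A.
Proof. by rewrite /frobenius -mxtrace_tr trmx_mul trmxK. Qed.

Lemma frobeniusDr (A B C : 'M[R]_m) :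
  frobenius A (B + C) = frobenius A B + frobenius A C.
Proof. by rewrite /frobenius mulmxDr mxtraceD. Qed.

Lemma frobeniusZr (A B : 'M[R]_m) a :
  frobenius A (a *: B) = a * frobenius A B.
Proof. by rewrite /frobenius -scalemxAr mxtraceZ. Qed.

Lemma frobeniusBl (A B C : 'M[R]_m) :
  frobenius (A - B) C = frobenius A C - frobenius B C.
Proof. by rewrite /frobenius linearB /= mulmxBl linearB. Qed.

Lemma frobenius_ge0 (A : 'M[R]_m) : 0 <= frobenius A A.
Proof.
by rewrite frobeniusE; do 2![apply: sumr_ge0 => ? _]; rewrite -expr2 sqr_ge0.
Qed.

Lemma frobenius_eq0 (A : 'M[R]_m) : frobenius A A = 0 -> A = 0.
Proof.
rewrite frobeniusE => /eqP; rewrite psumr_eq0 => [/allP A0|i _]; last first.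
  by apply: sumr_ge0 => j _; rewrite -expr2 sqr_ge0.
apply/matrixP => i j; rewrite mxE; apply/eqP.
have := A0 i (mem_index_enum _); rewrite psumr_eq0 => [/allP Ai0|k _]; last first.
  by rewrite -expr2 sqr_ge0.
by have := Ai0 j (mem_index_enum _); rewrite mulf_eq0 orbb.
Qed.

Lemma frobenius_CauchySchwarz (A B : 'M[R]_m) :
  frobenius A B ^+ 2 <= frobenius A A * frobenius B B.
Proof.
have [B0|B0] := eqVneq (frobenius B B) 0.
  by rewrite (frobenius_eq0 B0) /frobenius trmx0 mul0mx mulmx0 linear0 expr0n mulr0.
have Bgt0 : 0 < frobenius B B by rewrite lt_def B0 frobenius_ge0.
rewrite -subr_ge0 -(pmulr_rge0 _ Bgt0).
have := frobenius_ge0 (frobenius B B *: A + (- frobenius A B) *: B).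
rewrite !(frobeniusDr, frobeniusZr) ![frobenius (_ + _) _]frobeniusC.
rewrite !(frobeniusDr, frobeniusZr) (frobeniusC B A).
by congr (0 <= _); ring.
Qed.

Lemma frobenius_norm_triangle (A B : 'M[R]_m) :
  frobenius_norm (A + B) <= frobenius_norm A + frobenius_norm B.
Proof.
rewrite /frobenius_norm -[leRHS]ger0_norm ?addr_ge0 ?sqrtr_ge0 //.
rewrite -sqrtr_sqr ler_wsqrtr // sqrrD !sqr_sqrtr ?frobenius_ge0 //.
rewrite frobeniusDr ![frobenius (_ + _) _]frobeniusC !frobeniusDr.
rewrite (frobeniusC B A) -sqrtrM ?frobenius_ge0 //.
have : frobenius A B <= Num.sqrt (frobenius A A * frobenius B B).
  apply: le_trans (ler_norm _) _.
  by rewrite -sqrtr_sqr ler_wsqrtr // frobenius_CauchySchwarz.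
lra.
Qed.

Lemma frobenius_normZ a (A : 'M[R]_m) :
  frobenius_norm (a *: A) = `|a| * frobenius_norm A.
Proof.
rewrite /frobenius_norm frobeniusZr frobeniusC frobeniusZr mulrA -expr2.
by rewrite sqrtrM ?sqr_ge0 // sqrtr_sqr.
Qed.

Lemma frobenius_norm_eq0 A : frobenius_norm A = 0 -> A = 0.
Proof.
move=> /eqP; rewrite sqrtr_eq0 => A0; apply/val_inj/frobenius_eq0/eqP.
by rewrite eq_le A0 frobenius_ge0.
Qed.

HB.instance Definition _ := Lmodule_isNormed.Build R (symmx R m)
  (fun A B => frobenius_norm_triangle A B)
  (fun a A => frobenius_normZ a A) frobenius_norm_eq0.

Definition posdefmx (A : 'M[R]_m) : Prop :=
  forall x : 'cV[R]_m, x != 0 -> 0 < (x^T *m A *m x) 0 0.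

(** The Riesz representative of the differential; [gradientP] and
    [gradient_unique] show that the choice made by [get] is the only one. *)
Definition gradient (f : symmx R m -> R) A : symmx R m :=
  get [set G : symmx R m | forall H, 'd f A H = frobenius G H].

Lemma gradient_unique (f : symmx R m -> R) A (G : symmx R m) :
  (forall H, 'd f A H = frobenius G H) -> gradient f A = G.
Proof.
move=> GP; apply: get_unique => // G' G'P.
apply/eqP; rewrite -subr_eq0; apply/eqP/val_inj/frobenius_eq0.
have: frobenius G' (G' - G) - frobenius G (G' - G) = 0 by rewrite -G'P -GP subrr.
by rewrite -frobeniusBl.
Qed.

Let sym_part_subproof (X : 'M[R]_m) : 2^-1 *: (X + X^T) \in @sym_pred R m.
Proof. by rewrite sym_predE linearZ linearD /= trmxK addrC. Qed.

Let sym_part X := SymMx (sym_part_subproof X).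

Lemma gradientP (f : symmx R m -> R) A H : 'd f A H = frobenius (gradient f A) H.
Proof.
set L := 'd f A; pose G := \matrix_(i, j) L (sym_part (delta_mx i j)).
have GS : G \in @sym_pred R m.
  rewrite sym_predE; apply/eqP/matrixP => i j; rewrite !mxE; congr (L _).
  by apply: val_inj; rewrite /= !trmx_delta addrC.
have GP H' : L H' = frobenius (SymMx GS) H'.
  have {1}-> : H' = \sum_i \sum_j val H' i j *: sym_part (delta_mx i j).
    apply: val_inj; rewrite (raddf_sum val).
    under eq_bigr do rewrite (raddf_sum val) /=.
    transitivity (2^-1 *: (val H' + (val H')^T)).
      by rewrite symmx_tr -mulr2n -(scaler_nat 2 (val _)) scalerA mulVf ?pnatr_eq0 ?scale1r.
    rewrite {1 2}(matrix_sum_delta (val H')) linear_sum -big_split scaler_sumr.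
    apply: eq_bigr => i _; rewrite linear_sum -big_split scaler_sumr.
    apply: eq_bigr => j _.
    by rewrite /= linearZ -scalerDr scalerA mulrC -scalerA.
  rewrite frobeniusE linear_sum; apply: eq_bigr => i _.
  by rewrite linear_sum; apply: eq_bigr => j _; rewrite linearZ mxE mulrC.
by rewrite (gradient_unique GP) GP.
Qed.

End SymmetricMatrices.

Section Williamson.
Variables (R : realType) (n : nat).
Implicit Types (A M : 'M[R]_(n + n)) (d : 'rV[R]_n).

Definition symplJ : 'M[R]_(n + n) := block_mx 0 1%:M (- 1%:M) 0.

Definition symplecticmx M : Prop := M^T *m symplJ *m M = symplJ.

Definition diag2 d : 'M[R]_(n + n) := block_mx (diag_mx d) 0 0 (diag_mx d).

Definition is_sympl_eigs A d : Prop :=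
  [/\ forall j, 0 < d 0 j,
      forall i j : 'I_n, (i <= j)%N -> d 0 i <= d 0 j
    & exists2 M, symplecticmx M & M^T *m A *m M = diag2 d].

(** For positive definite [A], Williamson's theorem says that exactly one
    vector satisfies [is_sympl_eigs A]; the value is junk for other [A]. *)
Definition sympl_eigs A : 'rV[R]_n := get [set d | is_sympl_eigs A d].

Definition williamson_diagonalizer A M : Prop :=
  symplecticmx M /\ M^T *m A *m M = diag2 (sympl_eigs A).

(** Only meaningful on the positive definite matrices, which are open in
    [symmx R (n + n)]: differentiability and the gradient at a positive definite
    matrix do not depend on the values elsewhere. *)
Definition purity (A : symmx R (n + n)) : R :=
  (\prod_(j < n) sympl_eigs A 0 j)^-1.

End Williamson.

(* Main.v *)
Require Import Defs.
From HB Require Import structures.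
From mathcomp Require Import all_boot all_order all_algebra fingroup perm.
From mathcomp Require Import all_classical all_reals all_analysis.
From mathcomp Require Import ring lra.
From mathcomp.real_closed Require Import complex.

(** Symplectic matrices have determinant 1 or -1, so Williamson's theorem gives
    [det A = (prod_j d_j(A))^2] and [P(A) = (det A)^(-1/2)] for every positive
    definite [A].  Positive definiteness is an open condition, hence Jacobi's
    formula and the chain rule give
    [dP_A(H) = - (1/2) (det A)^(-1/2) tr(A^-1 H)], and [M^T A M = D] says that
    [A^-1 = M D^-1 M^T].

    Williamson's theorem is proved by picking symplectic pairs one at a time:
    [A J] is skew for the inner product of [A], so on the symplectic complement
    of the pairs already chosen, which it preserves, it has a complex
    eigenvector with purely imaginary eigenvalue; the real and imaginary parts
    of that eigenvector, rescaled, form the next pair. *)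

Set Implicit Arguments.
Unset Strict Implicit.
Unset Printing Implicit Defensive.

Import Order.TTheory GRing.Theory Num.Theory.
Import numFieldNormedType.Exports.

Local Open Scope ring_scope.
Local Open Scope classical_set_scope.

(** * Williamson's theorem *)

(* Real and imaginary parts [x], [y] of a complex eigenvector for the
   eigenvalue [a + i b]. *)
Lemma real_invariant_pair (R : rcfType) m (T : 'M[R]_m) : (0 < m)%N ->
  exists a b (x y : 'rV[R]_m), [/\ (x != 0) || (y != 0),
    x *m T = a *: x - b *: y & y *m T = b *: x + a *: y].
Proof.
move=> m_gt0.
pose toC := complex.real_complex R.
pose C : fieldType := complex.complex R.
pose re : C -> R := @complex.Re R; pose im : C -> R := @complex.Im R.
have [l /eigenvalueP[v vT v0]] := complex.Theorem7' (map_mx toC T) m_gt0.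
exists (re l), (im l), (map_mx re v), (map_mx im v).
have reD (u w : C) : re (u + w) = re u + re w by move: u w => [? ?] [? ?].
have imD (u w : C) : im (u + w) = im u + im w by move: u w => [? ?] [? ?].
have reM (u : C) c : re (u * toC c) = re u * c by case: u => ? ? /=; ring.
have imM (u : C) c : im (u * toC c) = im u * c by case: u => ? ? /=; ring.
split.
- apply: contra_neqT v0; rewrite negb_or !negbK => /andP[/eqP x0 /eqP y0].
  apply/rowP => j; move/rowP/(_ j): x0; move/rowP/(_ j): y0; rewrite !mxE.
  by case: (v 0 j) => ? ? /= -> ->.
- apply/rowP => j; move/rowP/(_ j)/(congr1 re): vT; rewrite !mxE.
  rewrite (big_morph re reD (erefl : re 0 = 0)).
  under eq_bigr do rewrite !mxE reM.
  move=> E; under eq_bigr do rewrite mxE.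
  by rewrite E; case: (l) (v 0 j) => ? ? [? ?] /=.
- apply/rowP => j; move/rowP/(_ j)/(congr1 im): vT; rewrite !mxE.
  rewrite (big_morph im imD (erefl : im 0 = 0)).
  under eq_bigr do rewrite !mxE imM.
  move=> E; under eq_bigr do rewrite mxE.
  by rewrite E; case: (l) (v 0 j) => ? ? [? ?] /=; ring.
Qed.

(** [B *m T *m pinvmx B] is the matrix of [T] restricted to the row space of [W], in the basis [B].
    A pair found there is carried back by [B], which is injective because its rows are free. *)
Lemma real_invariant_pair_sub (R : rcfType) m k (T : 'M[R]_m) (W : 'M[R]_(k, m)) :
  W != 0 -> stablemx W T ->
  exists a b (x y : 'rV[R]_m), [/\ (x != 0) || (y != 0),
    (x <= W)%MS && (y <= W)%MS,
    x *m T = a *: x - b *: y & y *m T = b *: x + a *: y].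
Proof.
move=> W0 WT; pose B := row_base W.
have BT : B *m T *m pinvmx B *m B = B *m T.
  by rewrite mulmxKpV // /B !eq_row_base (eqmxMr _ (eq_row_base W)).
have r0 : (0 < \rank W)%N by rewrite lt0n mxrank_eq0.
have [a [b [x [y [xy0 xT yT]]]]] := real_invariant_pair (B *m T *m pinvmx B) r0.
exists a, b, (x *m B), (y *m B); split.
- by rewrite !mulmx_free_eq0 ?row_base_free.
- by rewrite mulmx_sub ?eq_row_base // mulmx_sub ?eq_row_base.
- by rewrite -mulmxA -BT mulmxA xT mulmxBl -!scalemxAl.
- by rewrite -mulmxA -BT mulmxA yT mulmxDl -!scalemxAl.
Qed.

Section Williamson.
Variables (R : realType) (n : nat).
Local Notation J := (symplJ R n).
Implicit Types A M : 'M[R]_(n + n).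

Lemma symplJ_tr : J^T = - J.
Proof.
by rewrite tr_block_mx !trmx0 linearN /= trmx1 opp_block_mx opprK !oppr0.
Qed.

Lemma symplJ_sqr : J *m J = - 1%:M.
Proof.
rewrite mulmx_block !(mul0mx, mulmx0, mulmxN, mulNmx, mulmx1, addr0, add0r).
by rewrite scalar_mx_block opp_block_mx !oppr0.
Qed.

Lemma symplJ_skew p q (X : 'M[R]_(p, n + n)) (Y : 'M[R]_(q, n + n)) :
  (X *m J *m Y^T)^T = - (Y *m J *m X^T).
Proof. by rewrite !trmx_mul trmxK symplJ_tr mulNmx mulmxN mulmxA. Qed.

Lemma skew_form0 m (S : 'M[R]_m) (z : 'rV_m) : S^T = - S -> z *m S *m z^T = 0.
Proof.
move=> SN; set q := _ *m _; have qN : q^T = - q.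
  by rewrite /q !trmx_mul trmxK SN mulNmx mulmxN mulmxA.
apply/matrixP => i j; rewrite !ord1; move/matrixP/(_ 0 0): qN.
by rewrite !mxE => ?; lra.
Qed.

(* The rows [e_i] of [E] and [f_i] of [F] form a partial symplectic basis in
   which [e_i + i f_i] is an eigenvector of [A J] for [- i d_i]. *)
Definition williamson_pairs A k (E F : 'M[R]_(k, n + n)) (d : 'rV_k) :=
  [/\ forall j, 0 < d 0 j,
      E *m A = - (diag_mx d *m F *m J) /\ F *m A = diag_mx d *m E *m J
    & [/\ E *m J *m F^T = 1%:M, E *m J *m E^T = 0 & F *m J *m F^T = 0]].

Section Pairs.
Variable A : 'M[R]_(n + n).
Hypotheses (A_sym : A^T = A) (A_pos : posdefmx A).

Let q (z : 'rV[R]_(n + n)) : R := (z *m A *m z^T) 0 0.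

Let q_gt0 (z : 'rV[R]_(n + n)) : z != 0 -> 0 < q z.
Proof.
by move=> z0; rewrite /q -{1}[z]trmxK; apply: A_pos; rewrite trmx_eq0.
Qed.

Let q_ge0 z : 0 <= q z.
Proof.
have [->|/q_gt0/ltW//] := eqVneq z 0.
by rewrite /q !mul0mx mxE.
Qed.

Let mulJ_inj p (X Y : 'M[R]_(p, n + n)) : X *m J = Y *m J -> X = Y.
Proof.
move=> /(congr1 (mulmx^~ J)); rewrite /= -!mulmxA symplJ_sqr !mulmxN !mulmx1.
exact: oppr_inj.
Qed.

Lemma williamson_new_pair k (W : 'M[R]_(k, n + n)) :
  W != 0 -> stablemx W (A *m J) ->
  exists (c : R) (e f : 'rV[R]_(n + n)), [/\ 0 < c, (e <= W)%MS && (f <= W)%MS,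
    e *m A = - (c *: (f *m J)), f *m A = c *: (e *m J) & e *m J *m f^T = 1%:M].
Proof.
move=> W0 WT.
(* Normalization comes last: the relations give [q e = c * p] with [p] the value of [e *m J *m f^T],
   so [p] is positive and dividing both vectors by its square root yields a symplectic pair. *)
suff [c [e [f [c0 ef0 efW eA fA]]]] : exists (c : R) (e f : 'rV[R]_(n + n)),
    [/\ 0 < c, (e != 0) || (f != 0), (e <= W)%MS && (f <= W)%MS,
    e *m A = - (c *: (f *m J)) & f *m A = c *: (e *m J)].
  have e0 : e != 0.
    apply: contraTneq ef0 => e0; rewrite e0 eqxx /= negbK; apply/eqP.
    apply: mulJ_inj; rewrite mul0mx; apply: (scalerI (lt0r_neq0 c0)).
    by apply: oppr_inj; rewrite -eA e0 mul0mx scaler0 oppr0.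
  pose p := (e *m J *m f^T) 0 0.
  have qe : q e = c * p.
    rewrite /q eA mulNmx -scalemxAl -scalerN -symplJ_skew.
    by rewrite [LHS]mxE [X in _ * X]mxE.
  have p0 : 0 < p by rewrite -(pmulr_rgt0 _ c0) -qe q_gt0.
  pose s := (Num.sqrt p)^-1.
  exists c, (s *: e), (s *: f); split=> //.
  - by rewrite !scalemx_sub //; case/andP: efW.
  - by rewrite -!scalemxAl eA scalerN !scalerA mulrC.
  - by rewrite -!scalemxAl fA !scalerA mulrC.
  - rewrite linearZ /= -!scalemxAl -scalemxAr scalerA.
    apply/matrixP => i j; rewrite !ord1 [LHS]mxE -/p !mxE eqxx /s -expr2.
    by rewrite exprVn sqr_sqrtr ?ltW // mulVf ?lt0r_neq0.
have [a [b [x [y [xy0 xyW xT yT]]]]] := real_invariant_pair_sub W0 WT.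
have AJA : (A *m J *m A)^T = - (A *m J *m A).
  by rewrite !trmx_mul A_sym symplJ_tr mulNmx mulmxN mulmxA.
have qxy : (x *m A *m y^T) 0 0 = (y *m A *m x^T) 0 0.
  have -> : y *m A *m x^T = (x *m A *m y^T)^T.
    by rewrite !trmx_mul trmxK A_sym mulmxA.
  by rewrite [RHS]mxE.
(* Skewness of [A J A] kills its quadratic form at [x] and at [y]. Expanding both through the
   eigenvector relations and adding, the [b] terms cancel by symmetry of [A]. *)
have a0 : a = 0.
  have := skew_form0 x AJA; rewrite !mulmxA -[x *m A *m J]mulmxA xT.
  have := skew_form0 y AJA; rewrite !mulmxA -[y *m A *m J]mulmxA yT.
  rewrite !(mulmxDl, mulNmx) -!scalemxAl.
  move=> /matrixP/(_ 0 0) + /matrixP/(_ 0 0).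
  rewrite ![(_ + _ : matrix _ _ _) _ _]mxE ![(- _ : matrix _ _ _) _ _]mxE.
  rewrite ![(_ *: _ : matrix _ _ _) _ _]mxE ![(0 : matrix _ _ _) _ _]mxE qxy.
  rewrite -!/(q _) => yE xE.
  have /eqP : a * (q x + q y) = 0 by lra.
  rewrite mulf_eq0 => /orP[/eqP//|]; rewrite paddr_eq0 // => /andP[qx qy].
  case/orP: xy0 => /q_gt0; by rewrite ?(eqP qx) ?(eqP qy) ltxx.
have xA : x *m A = b *: (y *m J).
  apply: mulJ_inj; rewrite -mulmxA xT a0 scale0r sub0r -scalemxAl -mulmxA.
  by rewrite symplJ_sqr mulmxN mulmx1 scalerN.
have yA : y *m A = - (b *: (x *m J)).
  apply: mulJ_inj; rewrite -mulmxA yT a0 scale0r addr0 mulNmx -scalemxAl.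
  by rewrite -mulmxA symplJ_sqr mulmxN mulmx1 scalerN opprK.
(* Exchanging [x] and [y] flips the sign of the coefficient; [b = 0] would give [q x = q y = 0]. *)
have [b_gt0|b_lt0|b0] := ltgtP 0 b.
- by exists b, y, x; rewrite orbC andbC.
- by exists (- b), x, y; rewrite oppr_gt0 !scaleNr opprK.
- case/orP: xy0 => /q_gt0.
  by rewrite /q xA -b0 scale0r mul0mx mxE ltxx.
  by rewrite /q yA -b0 scale0r oppr0 mul0mx mxE ltxx.
Qed.

Lemma williamson_pairs_exist k : (k <= n)%N ->
  exists E F d, @williamson_pairs A k E F d.
Proof.
elim: k => [_|k IHk k_lt].
  exists 0, 0, 0; split=> [[]//||]; first by split; apply/matrixP => -[].
  by split; apply/matrixP => -[].
have [E [F [d [d0 [EA FA] [EF EE FF]]]]] := IHk (ltnW k_lt).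
have FE : F *m J *m E^T = - 1%:M.
  by rewrite -[LHS]opprK -symplJ_skew EF trmx1.
(* The symplectic complement of the pairs already chosen. It is cut out by [k + k] equations, fewer
   than [n + n], hence it is nonzero. *)
pose W := kermx (J *m (col_mx E F)^T).
have W0 : W != 0.
  rewrite -mxrank_eq0 mxrank_ker subn_eq0 -ltnNge.
  by apply: leq_ltn_trans (rank_leq_col _) _; rewrite -addnS leq_add // ltnW.
have WP p (z : 'M[R]_(p, n + n)) : (z <= W)%MS ->
    z *m J *m E^T = 0 /\ z *m J *m F^T = 0.
  move=> /sub_kermxP; rewrite tr_col_mx mulmxA mul_mx_row -[0]row_mx0.
  by case/eq_row_mx.
have [WE WF] := WP _ W (submx_refl _).
have AE : A *m E^T = J *m F^T *m diag_mx d.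
  rewrite -{1}A_sym -trmx_mul EA linearN /= !trmx_mul symplJ_tr tr_diag_mx.
  by rewrite mulNmx opprK mulmxA.
have AF : A *m F^T = - (J *m E^T *m diag_mx d).
  rewrite -{1}A_sym -trmx_mul FA !trmx_mul symplJ_tr tr_diag_mx.
  by rewrite mulNmx mulmxA.
(* Since [J *m J] is [-1], testing [z A J] against [E] and [F] gives [A *m E^T] and [A *m F^T] up to
   sign, and these lead back to [J *m F^T] and [J *m E^T]. *)
have stab p (z : 'M[R]_(p, n + n)) : z *m J *m E^T = 0 -> z *m J *m F^T = 0 ->
    z *m (A *m J) *m (J *m (col_mx E F)^T) = 0.
  move=> zE zF; rewrite tr_col_mx -!mulmxA (mulmxA J J) symplJ_sqr mulNmx.
  rewrite mul1mx !mulmxN mul_mx_row AE AF mul_mx_row mulmxN !mulmxA zE zF.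
  by rewrite !mul0mx oppr0 row_mx0 oppr0.
have WT : stablemx W (A *m J) by apply/sub_kermxP; exact: stab.
have [c [e [f [c0 /andP[/WP[eE eF] /WP[fE fF]] eA fA ef]]]] :=
  williamson_new_pair W0 WT.
have ee : e *m J *m e^T = 0 by apply: skew_form0 symplJ_tr.
have ff : f *m J *m f^T = 0 by apply: skew_form0 symplJ_tr.
have flip p r (X : 'M[R]_(p, n + n)) (Y : 'M[R]_(r, n + n)) :
    X *m J *m Y^T = 0 -> Y *m J *m X^T = 0.
  by move=> XY; rewrite -[LHS]opprK -symplJ_skew XY trmx0 oppr0.
rewrite -addn1; exists (col_mx E e), (col_mx F f), (row_mx d c%:M).
split.
- move=> j; rewrite mxE; case: splitP => i _ //.
  by rewrite !ord1 mxE eqxx.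
- have -> : diag_mx (row_mx d c%:M) = block_mx (diag_mx d) 0 0 c%:M.
    by rewrite diag_mx_row; congr block_mx; apply/matrixP => i j;
       rewrite !ord1 !mxE eqxx.
  rewrite !mul_block_col !mul0mx !addr0 !add0r !mul_scalar_mx !mul_col_mx.
  by rewrite EA FA eA fA opp_col_mx !scalemxAl.
- rewrite !tr_col_mx !(mul_col_mx _ _ J) !mul_col_row EF EE FF ef ee ff eE eF fF.
  by rewrite (flip _ _ _ _ eE) (flip _ _ _ _ fE) (flip _ _ _ _ fF)
    -scalar_mx_block !block_mx0.
Qed.

End Pairs.

(** * Ordering the pairs and assembling the symplectic matrix *)

Lemma perm_nondecreasing (d : 'rV[R]_n) :
  exists s : 'S_n, forall i j : 'I_n, (i <= j)%N -> d 0 (s i) <= d 0 (s j).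
Proof.
pose t := [tuple d 0 i | i < n].
have /tuple_permP[s sE] : perm_eq (sort <=%O t) t by rewrite perm_sort.
exists s => i j ij.
have nthE k : d 0 (s k) = nth 0 (sort <=%O t) k.
  by rewrite sE -tnth_nth !tnth_mktuple.
rewrite !nthE; apply: sorted_leq_nth => //; first exact: le_trans.
- exact: sort_le_sorted.
- by rewrite inE size_sort size_tuple.
- by rewrite inE size_sort size_tuple.
Qed.

Lemma williamson_exists A : A^T = A -> posdefmx A ->
  exists d, is_sympl_eigs A d.
Proof.
move=> A_sym A_pos.
have [E [F [d [d0 [EA FA] [EF EE FF]]]]] :=
  williamson_pairs_exist A_sym A_pos (leqnn n).
have [s ds] := perm_nondecreasing d.
pose P : 'M[R]_n := perm_mx s.
(* The same permutation acts on the [e_i] and on the [f_i], so pairs stay together and the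
   symplectic relations survive the sorting. *)
pose S := block_mx P 0 0 P.
pose N := S *m col_mx E F.
have gram X : N *m X *m N^T = S *m (col_mx E F *m X *m row_mx E^T F^T) *m S^T.
  by rewrite /N trmx_mul tr_col_mx !mulmxA.
have FE : F *m J *m E^T = - 1%:M.
  by rewrite -[LHS]opprK -symplJ_skew EF trmx1.
have PP : P *m P^T = 1%:M by rewrite tr_perm_mx -perm_mxM mulgV perm_mx1.
have PDP : P *m diag_mx d *m P^T = diag_mx (col_perm s d).
  rewrite tr_perm_mx -row_permE -col_permE; apply/matrixP => i j.
  by rewrite !mxE (inj_eq perm_inj).
exists (col_perm s d); split=> [j|i j ij|]; first by rewrite mxE.
  by rewrite !mxE ds.
exists N^T.
  rewrite /symplecticmx trmxK gram (mul_col_mx E).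
  rewrite mul_col_row EE EF FE FF tr_block_mx !trmx0 !mulmx_block.
  by rewrite !(mul0mx, mulmx0, mulmx1, addr0, add0r, mulmxN, mulNmx) PP.
rewrite trmxK gram (mul_col_mx E) EA FA.
rewrite mul_col_row !mulNmx -!(mulmxA (diag_mx d)) FE FF EE EF.
rewrite tr_block_mx !trmx0 !mulmx_block.
by rewrite !(mul0mx, mulmx0, mulmx1, addr0, add0r, mulmxN, mulNmx, opprK, oppr0)
  PDP.
Qed.

(** * Determinants and symplectic eigenvalues *)

Lemma det_diag2 (d : 'rV[R]_n) : \det (diag2 d) = (\prod_j d 0 j) ^+ 2.
Proof. by rewrite det_ublock det_diag expr2. Qed.

Lemma det_symplectic M : symplecticmx M -> \det M ^+ 2 = 1.
Proof.
move=> /(congr1 determinant); rewrite !det_mulmx det_tr => detM.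
have J0 : \det J != 0.
  rewrite -unitfE -unitmxE; apply: (proj1 (mulmx1_unit (_ : J *m - J = 1%:M))).
  by rewrite mulmxN symplJ_sqr opprK.
by apply: (mulIf J0); rewrite mul1r -[RHS]detM; ring.
Qed.

Lemma sympl_eigsP A : A^T = A -> posdefmx A -> is_sympl_eigs A (sympl_eigs A).
Proof. by move=> As Ap; have [d] := williamson_exists As Ap; exact: getI. Qed.

Lemma prod_sympl_eigs A : A^T = A -> posdefmx A ->
  \prod_j sympl_eigs A 0 j = Num.sqrt (\det A).
Proof.
move=> As Ap; have [d0 _ [M MJ /(congr1 determinant)]] := sympl_eigsP As Ap.
rewrite !det_mulmx det_tr det_diag2 mulrAC -expr2 det_symplectic // mul1r => ->.
by rewrite sqrtr_sqr ger0_norm // prodr_ge0 // => j _; exact: ltW.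
Qed.

End Williamson.

(** * The differential of the determinant *)

(** Differentiability is local: both functions have the same first-order expansion at [a]. This
    transfers the differential of the inverse square root of the determinant to the purity, as the
    two are known to agree only near a positive definite matrix. *)
Lemma near_eq_is_diff (K : numFieldType) (V W : normedModType K)
    (f g df : V -> W) (a : V) :
  (\forall x \near a, f x = g x) -> is_diff a f df -> is_diff a g df.
Proof.
move=> fg [fa <-].
have gE : g \o shift a = cst (g a) + 'd f a +o_ 0 id.
  have fg0 : \forall h \near 0, f (h + a) = g (h + a).
    by have := fg; rewrite (near_shift 0) subr0.
  apply/eqaddoP => e e0; have /eqaddoP/(_ e e0) := diff_locally fa.
  apply: filter_app; near=> h.
  by rewrite !fctE (nbhs_singleton fg) (near fg0 h).
have dgE : 'd g a = 'd f a :> (V -> W).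
  by apply: diff_unique gE; exact: diff_continuous.
apply: DiffDef => //; apply/diff_locallyP; rewrite dgE; split => //.
exact: diff_continuous.
Unshelve. all: by end_near. Qed.

Section Det.
Variables (R : realType) (V : normedModType R).

Lemma is_diff_sum (I : Type) (r : seq I) (f df : I -> V -> R) x :
  (forall i, is_diff x (f i) (df i)) ->
  is_diff x (fun z => \sum_(i <- r) f i z) (fun h => \sum_(i <- r) df i h).
Proof.
move=> dfx; elim: r => [|i r IHr].
  have -> : (fun z => \sum_(i <- [::]) f i z) = cst 0.
    by apply/funext => z; rewrite big_nil.
  by apply: is_diff_eq; apply/funext => z; rewrite big_nil.
have -> : (fun z => \sum_(j <- i :: r) f j z) =
    f i + (fun z => \sum_(j <- r) f j z).
  by apply/funext => z; rewrite big_cons.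
by apply: is_diff_eq; apply/funext => z; rewrite big_cons.
Qed.

Lemma is_diff_prod (I : eqType) (r : seq I) (f df : I -> V -> R) x :
  uniq r -> (forall i, is_diff x (f i) (df i)) ->
  is_diff x (fun z => \prod_(i <- r) f i z)
    (fun h => \sum_(i <- r) (\prod_(j <- r | j != i) f j x) * df i h).
Proof.
move=> + dfx; elim: r => [_|i r IHr /= /andP[ir /IHr {}IHr]].
  have -> : (fun z => \prod_(i <- [::]) f i z) = cst 1.
    by apply/funext => z; rewrite big_nil.
  by apply: is_diff_eq; apply/funext => z; rewrite big_nil.
have -> : (fun z => \prod_(j <- i :: r) f j z) =
    f i * (fun z => \prod_(j <- r) f j z).
  by apply/funext => z; rewrite big_cons.
apply: is_diff_eq; apply/funext => h; rewrite big_cons.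
rewrite big_cons eqxx /= [LHS]addrC; congr (_ + _).
  congr (_ * _); rewrite [LHS]big_seq [RHS]big_mkcond [RHS]big_seq.
  apply: eq_bigr => j jr; case: eqP => // ji.
  by rewrite -ji jr in ir.
rewrite -[LHS]/(_ * _) mulr_sumr [LHS]big_seq [RHS]big_seq.
apply: eq_bigr => j jr; rewrite big_cons ifT ?mulrA //.
by apply: contraNneq ir => ->.
Qed.

(** Jacobi's formula, from the product rule applied to each term of the Leibniz expansion. *)
Lemma is_diff_det m (F dF : V -> 'M[R]_m) x :
  (forall i j, is_diff x (fun z => F z i j) (fun h => dF h i j)) ->
  is_diff x (fun z => \det (F z)) (fun h => \tr (\adj (F x) *m dF h)).
Proof.
move=> dFx.
have dprod (s : 'S_m) := is_diff_prod (index_enum_uniq 'I_m)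
  (fun i => dFx i (s i)).
have dterm (s : 'S_m) := is_diffZ ((-1) ^+ s) (dprod s).
have := is_diff_sum (index_enum 'S_m) dterm.
rewrite /determinant => H; apply: is_diff_eq H _; apply/funext => h.
(* Regrouped by the differentiated row [i], the sum is that of the determinants of [F x] with row
   [i] replaced by that of [dF h]. Expanding along row [i] yields the cofactors of [F x], which do
   not see that row. *)
pose B i := \matrix_(k, l) (if k == i then dF h i l else F x k l).
transitivity (\sum_i \det (B i)).
  rewrite exchange_big /=; apply: eq_bigr => s _.
  rewrite -[LHS]/(_ * _) mulr_sumr; apply: eq_bigr => i _; congr (_ * _).
  rewrite [RHS](bigD1 i) //= mxE eqxx mulrC; congr (_ * _).
  by apply: eq_bigr => j /negPf ji; rewrite mxE ji.
rewrite mxtrace_mulC; apply: eq_bigr => i _.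
rewrite (expand_det_row _ i) !mxE; apply: eq_bigr => j _.
rewrite !mxE eqxx; congr (_ * (_ * \det _)).
by apply/matrixP => k l; rewrite !mxE eq_sym (negPf (neq_lift _ _)).
Qed.

End Det.

(** * Positive definite matrices and the purity *)

Section Symmetric.
Variables (R : realType) (m : nat).
Implicit Types A X : symmx R m.

Lemma frobenius_entry (A : 'M[R]_m) i j : `|A i j| <= frobenius_norm A.
Proof.
rewrite -sqrtr_sqr ler_wsqrtr // frobeniusE (bigD1 i) //= (bigD1 j) //=.
rewrite -expr2 -addrA lerDl addr_ge0 //.
  by apply: sumr_ge0 => k _; rewrite -expr2 sqr_ge0.
by do 2![apply: sumr_ge0 => ? _]; rewrite -expr2 sqr_ge0.
Qed.

(** The coordinate is linear and bounded by the Frobenius norm, so it is its own differential. *)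
Lemma is_diff_symmx_entry A i j :
  is_diff A (fun X : symmx R m => symmx_val X i j : R) (fun H => symmx_val H i j).
Proof.
have lin : linear (fun X : symmx R m => symmx_val X i j : R).
  by move=> a X Y; rewrite /= !mxE.
pose linM := GRing.isLinear.Build _ _ _ _ _ lin.
pose f : {linear symmx R m -> R} := HB.pack (fun X : symmx R m => symmx_val X i j) linM.
have fc : continuous f.
  apply: bounded_linear_continuous; apply/linear_boundedP; exists 1; split=> // r r1 X.
  apply: le_trans (frobenius_entry _ _ _) _.
  by rewrite ler_peMl ?sqrtr_ge0 // ltW.
apply: DiffDef; first exact: (linear_differentiable A fc).
exact: (diff_lin A fc).
Qed.

Lemma is_diff_det_symmx A :
  is_diff A (fun X : symmx R m => \det (symmx_val X))
    (fun H : symmx R m => \tr (\adj (symmx_val A) *m symmx_val H)).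
Proof.
apply: (@is_diff_det _ _ _ (@symmx_val R m) (@symmx_val R m)) => i j.
exact: is_diff_symmx_entry.
Qed.

(** The form is the Frobenius product of [y *m y^T] with [N], and [y *m y^T] has Frobenius norm
    [y^T *m y]: this is Cauchy-Schwarz. *)
Lemma quad_form_le (N : 'M[R]_m) (y : 'cV[R]_m) :
  `|(y^T *m N *m y) 0 0| <= (y^T *m y) 0 0 * frobenius_norm N.
Proof.
have tr1 (Z : 'M[R]_1) : Z 0 0 = \tr Z by rewrite /mxtrace big_ord1.
have yyE (Z : 'M[R]_m) : (y^T *m Z *m y) 0 0 = frobenius (y *m y^T) Z.
  by rewrite tr1 /frobenius trmx_mul trmxK -mulmxA mxtrace_mulC -mulmxA mxtrace_mulC.
have yy : frobenius (y *m y^T) (y *m y^T) = (y^T *m y) 0 0 ^+ 2.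
  by rewrite -yyE mulmxA -mulmxA [LHS]mxE big_ord1.
have y0 : 0 <= (y^T *m y) 0 0.
  by rewrite mxE sumr_ge0 // => i _; rewrite mxE -expr2 sqr_ge0.
rewrite yyE -[leRHS]ger0_norm ?mulr_ge0 ?sqrtr_ge0 //.
rewrite -!sqrtr_sqr ler_wsqrtr // exprMn -yy sqr_sqrtr ?frobenius_ge0 //.
exact: frobenius_CauchySchwarz.
Qed.

End Symmetric.

(** * Openness of positive definiteness and the differential of the purity *)

Section Purity.
Variables (R : realType) (n : nat).
Implicit Types A X : symmx R (n + n).

Lemma sqnorm_col k (y : 'cV[R]_k) : (y^T *m y) 0 0 = \sum_i y i 0 ^+ 2.
Proof. by rewrite mxE; apply: eq_bigr => i _; rewrite mxE expr2. Qed.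

Lemma diag_form k (d : 'rV[R]_k) (y : 'cV[R]_k) :
  (y^T *m diag_mx d *m y) 0 0 = \sum_i d 0 i * y i 0 ^+ 2.
Proof.
rewrite -mulmxA mul_diag_mx mxE; apply: eq_bigr => i _.
by rewrite !mxE; ring.
Qed.

Lemma diag2E (d : 'rV[R]_n) : diag2 d = diag_mx (row_mx d d).
Proof. by rewrite diag_mx_row. Qed.

(** In the coordinates [x = M *m y], the form of [A] is at least [c] times the squared norm of [y],
    where [c] is the least symplectic eigenvalue, while a perturbation of norm [N] contributes at
    most [k * N] times it. *)
Lemma posdefmx_open A : (0 < n)%N -> posdefmx A ->
  \forall X \near A, posdefmx (symmx_val X).
Proof.
move=> n_gt0 Ap.
have [d0 dle [M MJ MA]] := sympl_eigsP (symmx_tr A) Ap.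
set d := sympl_eigs A in d0 dle MA.
pose c := d 0 (Ordinal n_gt0).
have c_gt0 : 0 < c by exact: d0.
have cd j : c <= d 0 j by exact: dle.
have Mu : M \in unitmx.
  by rewrite unitmxE unitfE -sqrf_eq0 det_symplectic ?oner_eq0.
pose k := frobenius_norm (M^T *m M).
have k_ge0 : 0 <= k by exact: sqrtr_ge0.
have k1_gt0 : 0 < k + 1 by rewrite ltr_pwDr.
(* The [+ 1] makes the denominator positive from [k_ge0] alone; a perturbation below this radius
   still satisfies [k * N < c]. *)
have e_gt0 : 0 < c / (k + 1) by rewrite divr_gt0.
near=> X.
have XA : frobenius_norm (symmx_val (X - A)) < c / (k + 1).
  rewrite -[ltLHS]/(`|X - A|) distrC; near: X; exact: nbhsx_ballx.
move=> x x0.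
have [y xE] : exists y, x = M *m y by exists (invmx M *m x); rewrite mulKVmx.
have y_gt0 : 0 < (y^T *m y) 0 0.
  rewrite sqnorm_col lt_neqAle sumr_ge0 ?andbT => [|i _]; last exact: sqr_ge0.
  rewrite eq_sym psumr_eq0 => [|i _]; last exact: sqr_ge0.
  apply: contraNN x0 => /allP y0; rewrite xE.
  suff -> : y = 0 by rewrite mulmx0.
  apply/colP => i; rewrite [RHS]mxE; apply/eqP; rewrite -sqrf_eq0.
  exact: y0 (mem_index_enum _).
have Ax : c * (y^T *m y) 0 0 <= (x^T *m symmx_val A *m x) 0 0.
  rewrite {1 2}xE trmx_mul !mulmxA -2!(mulmxA y^T) MA diag2E diag_form sqnorm_col.
  rewrite mulr_sumr; apply: ler_sum => i _; rewrite ler_wpM2r ?sqr_ge0 //.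
  by rewrite mxE; case: splitP => j _; exact: cd.
have xx : (x^T *m x) 0 0 <= (y^T *m y) 0 0 * k.
  rewrite {1 2}xE trmx_mul !mulmxA -(mulmxA y^T).
  exact: le_trans (ler_norm _) (quad_form_le _ _).
have Xx := quad_form_le (symmx_val (X - A)) x.
have -> : symmx_val X = symmx_val A + symmx_val (X - A).
  by rewrite -[LHS]/(val X) -[in LHS](subrK A X) addrC.
rewrite mulmxDr mulmxDl mxE.
have xx0 : 0 <= (x^T *m x) 0 0.
  by rewrite sqnorm_col sumr_ge0 // => i _; exact: sqr_ge0.
move: XA Xx; set N := frobenius_norm _; set p := _ 0 0; set u := _ 0 0 in xx xx0 *.
set v := _ 0 0 in y_gt0 Ax xx *.
rewrite ltr_pdivlMr // => N_lt pu.
have N_ge0 : 0 <= N by exact: sqrtr_ge0.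
have : - p <= u * N by rewrite (le_trans _ pu) // -normrN ler_norm.
have : u * N <= v * k * N by rewrite ler_wpM2r.
have : v * (N * (k + 1)) < v * c by rewrite ltr_pM2l.
have : 0 <= v * N by rewrite mulr_ge0 // ltW.
by have := Ax; lra.
Unshelve. all: by end_near. Qed.

Lemma det_posdefmx_gt0 A : posdefmx A -> 0 < \det (symmx_val A).
Proof.
move=> Ap; rewrite -sqrtr_gt0 -(prod_sympl_eigs (symmx_tr A) Ap).
by apply: prodr_gt0 => j _; have [] := sympl_eigsP (symmx_tr A) Ap.
Qed.

Lemma is_diff_invsqrt (t : R) : 0 < t ->
  is_diff t (fun s : R => (Num.sqrt s)^-1)
    (fun h => - (2 * t * Num.sqrt t)^-1 * h).
Proof.
move=> t0; have st0 : Num.sqrt t != 0 by rewrite sqrtr_eq0 -ltNge.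
have [ds dsE] := is_derive1_sqrt t0.
have dt : differentiable (Num.sqrt : R -> R) t by apply/derivable1_diffP.
apply: DiffDef; first exact: differentiableV.
rewrite diffV // diff1E // derive1E dsE; apply/funext => h /=.
rewrite -[LHS]/(_ * (_ * _)) sqr_sqrtr ?ltW // !invfM; ring.
Qed.

Lemma is_diff_purity A : (0 < n)%N -> posdefmx A ->
  is_diff A (@purity R n) (fun H : symmx R (n + n) =>
    - (2 * Num.sqrt (\det (symmx_val A)))^-1 * \tr (invmx (symmx_val A) *m symmx_val H)).
Proof.
move=> n_gt0 Ap; have D0 := det_posdefmx_gt0 Ap.
have Au : symmx_val A \in unitmx by rewrite unitmxE unitfE gt_eqF.
pose g X := (Num.sqrt (\det (symmx_val X)))^-1.
apply: (@near_eq_is_diff _ _ _ g).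
  near=> X; rewrite /g /purity prod_sympl_eigs //; first exact: symmx_tr.
  by near: X; exact: posdefmx_open.
have := is_diff_comp (is_diff_det_symmx A) (is_diff_invsqrt D0).
move=> H; apply: is_diff_eq H _; apply/funext => h /=.
(* The adjugate is [\det A] times the inverse, which cancels the factor [t] in the derivative of the
   inverse square root. *)
rewrite /invmx Au -scalemxAl mxtraceZ; field.
by rewrite lt0r_neq0 // sqrtr_eq0 -ltNge D0.
Unshelve. all: by end_near. Qed.

Lemma invmx_williamson A M : posdefmx A -> williamson_diagonalizer A M ->
  M *m invmx (diag2 (sympl_eigs A)) *m M^T = invmx (symmx_val A).
Proof.
move=> Ap [MJ MA]; set D := diag2 _ in MA *.
have D0 := det_posdefmx_gt0 Ap.
have Au : symmx_val A \in unitmx by rewrite unitmxE unitfE gt_eqF.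
have Mu : M \in unitmx.
  by rewrite unitmxE unitfE -sqrf_eq0 det_symplectic ?oner_eq0.
have Du : D \in unitmx by rewrite -MA !unitmx_mul unitmx_tr Mu Au.
set B := LHS.
have MTu : M^T \in unitmx by rewrite unitmx_tr.
(* [M^T A M] is [D], which cancels against the [D^-1] inside [B]; cancelling [M^T] on the left then
   shows that [B] inverts [A]. *)
have MB : M^T *m (symmx_val A *m B) = M^T.
  by rewrite /B !mulmxA MA mulmxV // mul1mx.
have AB : symmx_val A *m B = 1%:M by rewrite -(mulKmx MTu (_ *m B)) MB mulVmx.
by rewrite -[LHS](mulKmx Au) AB mulmx1.
Qed.

End Purity.

Theorem mainTheorem5 (R : realType) (n : nat) (n_gt0 : (0 < n)%N) :
  (forall A : symmx R (n + n), posdefmx A -> differentiable (@purity R n) A) /\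
  (forall (A : symmx R (n + n)) (M : 'M[R]_(n + n)),
     posdefmx A -> williamson_diagonalizer A M ->
     symmx_val (gradient (@purity R n) A) =
       - (2 * Num.sqrt (\det A))^-1
         *: (M *m invmx (diag2 (sympl_eigs A)) *m M^T)).
Proof.
split=> [A Ap|A M Ap AM]; first by have [] := is_diff_purity n_gt0 Ap.
have [_ dP] := is_diff_purity n_gt0 Ap.
rewrite invmx_williamson //.
(* The candidate must lie in the symmetric space before uniqueness of the Riesz representative can
   identify it with the gradient. *)
have GS : - (2 * Num.sqrt (\det A))^-1 *: invmx A \in @sym_pred R (n + n).
  by rewrite sym_predE linearZ /= trmx_inv symmx_tr.
rewrite (gradient_unique (G := SymMx GS)) // => H.
rewrite dP /frobenius /= linearZ /= trmx_inv symmx_tr.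
by rewrite -scalemxAl mxtraceZ.
Qed.
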